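(* Suppose that $-1<m<1<n$ and $0<\alpha\leq 1$. Then there exist positive constants $C$, $\beta$ and $N_0$ (depending on $m,n,\alpha$ but not on $N$) such that for all $N>N_0$ and all critical points $X_N=(x_1,\dots,x_N)$ of the energy $E$, we have $$w_N\leq CN^{1-\beta}.$$ In particular, any sequence of critical points $\{X_N\}_{N=1}^\infty$ is a bunching sequence.
   Context: For real $-1<m<1<n$ (not necessarily integers) the pair potential is, for $x\neq 0$, $V(x)=-\frac1m|x|^{-m}+\frac1n|x|^{-n}$ if $m\neq0$, and $V(x)=\log|x|+\frac1n|x|^{-n}$ if $m=0$. For $0\le\alpha\le1$ and a step configuration $X_N=(x_1,\dots,x_N)$ with $x_1<\cdots<x_N$, the energy is $E[X_N]=\sum_{1\le i<j\le N,\ j-i\le\lfloor N^\alpha\rfloor}V(x_j-x_i)$. A critical point of $E$ is a configuration $x_1<\cdots<x_N$ with $\partial E/\partial x_i=0$ for all $i=1,\dots,N$. The system size is $w_N:=x_N-x_1$. A sequence of configurations $\{X_N\}$ is a bunching sequence if $\limsup_{N\to\infty}w_N/N=0$. *)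

(* Defs.v *)
From HB Require Import structures.
From mathcomp Require Import all_boot all_order all_algebra.
From mathcomp Require Import all_classical all_reals all_analysis.

Set Implicit Arguments.
Unset Strict Implicit.
Unset Printing Implicit Defensive.

Import Order.TTheory GRing.Theory Num.Theory.
Import numFieldNormedType.Exports.

Local Open Scope ring_scope.

(* Only the values at x != 0 are meaningful. *)
Definition potential (R : realType) (m n : R) (x : R) : R :=
  (if m == 0 then ln `|x| else - m^-1 * `|x| `^ (- m))
  + n^-1 * `|x| `^ (- n).

(* x_1, ..., x_N are the entries x 0 i, with i : 'I_N counted from 0. *)
Definition energy (R : realType) (m n alpha : R) (N : nat) (x : 'rV[R]_N) : R :=
  \sum_(i < N)
    \sum_(j < N | (i < j)%N &&
                  ((j - i)%N%:Z <= Num.floor (N%:R `^ alpha : R)))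
      potential m n (x 0 j - x 0 i).

Definition step_configuration (R : realType) (N : nat) (x : 'rV[R]_N) : Prop :=
  forall i j : 'I_N, (i < j)%N -> x 0 i < x 0 j.

(* is_derive asserts that the partial derivative in the direction of the i-th
   standard basis vector exists and equals 0. *)
Definition critical_point (R : realType) (m n alpha : R) (N : nat)
    (x : 'rV[R]_N) : Prop :=
  step_configuration x /\
  forall i : 'I_N, is_derive x (delta_mx 0 i) (energy m n alpha (N := N)) 0.

(* The value 0 for the empty configuration is a dummy. *)
Definition system_size (R : realType) (N : nat) : 'rV[R]_N -> R :=
  match N with
  | 0%N => fun=> 0
  | N'.+1 => fun x => x 0 ord_max - x 0 ord0
  end.

(* The upper limit is taken in \bar R, so that it is +oo, not a default value,
   when the ratios are unbounded. The term N = 0 does not affect it. *)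
Definition bunching (R : realType) (X : forall N : nat, 'rV[R]_N) : Prop :=
  limn_esup (fun N : nat => (system_size (X N) / N%:R)%:E) = 0%E.

(* Main.v *)
From HB Require Import structures.
Require Import Defs.
From mathcomp Require Import all_boot all_order all_algebra.
From mathcomp Require Import all_classical all_reals all_analysis.
From mathcomp Require Import ring lra zify.
Import Order.TTheory GRing.Theory Num.Theory.
Import numFieldNormedType.Exports.
Local Open Scope ring_scope.

(** Why critical points bunch.

    Write F(r) = r^(-m-1) - r^(-n-1) for the derivative of the potential at
    r > 0: it is negative (repulsion) for r < 1 and positive (attraction) for
    r > 1.  Moving all the particles x_1, .., x_c rigidly does not change the
    energy to first order at a critical point, so the interaction forces
    transmitted across any cut between x_c and x_(c+1) add up to zero
    ([cut_force_balance]).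

    A gap larger than 1 would make all the forces across its cut attractive;
    hence all gaps are at most 1 ([gap_le1]), and w_N <= N.  To gain a power of
    N, compare attraction and repulsion across a gap of length at least d.
    If p is such that all pairs with index difference below 2p interact, the p
    particles on each side of the cut give p^2 pairs at distance at most 2p,
    so that the attraction is at least p^2 (2p)^(-m-1), which grows like
    p^(1-m).  The repulsion at distances above 2 is at most a fixed fraction,
    smaller than 1, of the attraction, and the repulsion at distances between d
    and 2 is at most d^(-n-1) per pair.  So the number of crossing pairs at
    distance at most 2, and a fortiori the square of the number of particles
    within distance 2 of x_c, is at least of order p^(1-m) d^(n+1)
    ([crowd_ge]): a gap that is not small has to lie in a crowd.

    Crowded places are short in total.  Weighting each gap by the number of
    particles within distance 2 of its left end and exchanging the sums, each particle sees
    gaps of total length at most 5, so that the weighted sum is at most 5N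
    ([sum_gap_crowd]).  If P is a lower bound for the crowds, the system size
    is then at most N d (the small gaps) + 5N/P (the gaps in crowds) + 2p (the
    gaps too close to the ends of the chain to have p particles on both
    sides): this is [size_le_cuts].

    It remains to choose p of order N^(alpha/2), which is admissible because
    2p <= N^alpha for large N, and d = N^(-beta).  Then P may be taken of
    order N^beta as soon as alpha (1-m)/2 - beta (n+1) = 2 beta, that is, for
    beta = alpha (1-m) / (2 (n+3)), and the three terms are all of order
    N^(1-beta) ([system_size_le]). *)

(** * Force balance across a cut *)

(** The derivative of the potential on the positive half-line, one formula for
    both cases [m = 0] and [m != 0]. *)
Definition force {R : realType} (m n r : R) : R := r `^ (- m - 1) - r `^ (- n - 1).

Lemma is_derive_potential (R : realType) (m n r : R) : 0 < n -> 0 < r ->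
  is_derive r 1 (potential m n) (force m n r).
Proof.
move=> n0 r0.
have near_pos : \near r, 0 < r by exact: lt_nbhsr.
set f := fun s : R => (if m == 0 then ln s else - m^-1 * s `^ (- m)) + n^-1 * s `^ (- n).
apply: (@near_eq_is_derive _ _ _ f).
  near=> s; rewrite /f /potential ger0_norm //.
  by apply: ltW; near: s.
have dpow k : k != 0 -> is_derive r 1 (fun s : R => k^-1 * s `^ (- k)) (- r `^ (- k - 1)).
  move=> k0; have h := is_derive1_powR (- k) r0.
  have := @is_deriveZ _ _ _ _ k^-1 _ _ _ h.
  move=> hk; apply: (is_derive_eq hk).
  by rewrite /GRing.scale /= mulrA mulrN mulVf // mulN1r.
suff : is_derive r 1 (fun s : R => if m == 0 then ln s else - m^-1 * s `^ (- m))
    (r `^ (- m - 1)).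
  by move=> hm; apply: (is_deriveD hm); apply: dpow; rewrite gt_eqF.
have [->|m0] := eqVneq m 0.
  rewrite oppr0 sub0r powR_inv1 ?ltW //.
  exact: is_derive1_ln.
have -> : (fun s : R => - m^-1 * s `^ (- m)) = - (fun s => m^-1 * s `^ (- m)).
  by apply/funext => s; rewrite mulNr.
by rewrite -[X in is_derive _ _ _ X]opprK; apply: is_deriveN; apply: dpow.
Unshelve. all: by end_near. Qed.

(** The chain rule for a pair interaction; the differential of
    [y |-> y 0 j - y 0 i] is the map itself, because it is linear. *)
Lemma is_derive_coordB (R : realType) N (x v : 'rV[R]_N) (i j : 'I_N)
    (V : R -> R) (dV : R) : is_derive (x 0 j - x 0 i) 1 V dV ->
  is_derive x v (fun y : 'rV[R]_N => V (y 0 j - y 0 i)) ((v 0 j - v 0 i) * dV).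
Proof.
move=> [dV1 dVE].
have dV' : differentiable V (x 0 j - x 0 i) by apply/derivable1_diffP.
pose g (y : 'rV[R]_N) : R := y 0 j - y 0 i.
have dg : differentiable g x.
  by apply: differentiableB; exact: differentiable_coord.
have dc : differentiable (V \o g) x by apply: differentiable_comp.
apply: DeriveDef; first by apply: diff_derivable; exact: dc.
rewrite (_ : (fun _ => _) = V \o g) // deriveE // diff_comp //=.
rewrite diff1E //; congr (_ * _); last by rewrite derive1E.
have lg : linear g by move=> a y z; rewrite /g !mxE [a *: _]mulrBr opprD addrACA.
pose gM := GRing.isLinear.Build _ _ _ _ _ lg.
pose gL : {linear _ -> _} := HB.pack g gM.
have cg : continuous gL.
  move=> y; apply: differentiable_continuous.
  by apply: differentiableB; exact: differentiable_coord.
by rewrite -[g]/(gL : _ -> _) diff_lin.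
Qed.

Definition in_range {R : realType} (alpha : R) (N : nat) (i j : nat) : bool :=
  (i < j)%N && ((j - i)%N%:Z <= Num.floor (N%:R `^ alpha : R)).

(** The expression for the derivative is linear in the direction [v], which is
    what allows the partial derivatives to be combined. *)
Lemma is_derive_energy (R : realType) (m n alpha : R) N (x v : 'rV[R]_N) :
  0 < n -> step_configuration x ->
  is_derive x v (energy m n alpha (N := N))
    (\sum_(i < N) \sum_(j < N | in_range alpha N i j)
       (v 0 j - v 0 i) * force m n (x 0 j - x 0 i)).
Proof.
move=> n0 xincr.
have -> : energy m n alpha (N := N) =
    \sum_(i < N) \sum_(j < N) fun y : 'rV[R]_N =>
      if in_range alpha N i j then potential m n (y 0 j - y 0 i) else 0.
  apply/funext => y; rewrite /energy fct_sumE; apply: eq_bigr => i _.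
  by rewrite fct_sumE big_mkcond.
apply: is_derive_sum => i; rewrite [X in is_derive _ _ _ X]big_mkcond /=; apply: is_derive_sum => j.
case: ifPn => [/andP[ij _]|_]; last exact: is_derive_cst.
by apply: is_derive_coordB; apply: is_derive_potential => //; rewrite subr_gt0 xincr.
Qed.

(** The derivative of the energy vanishes in every direction, in particular in
    that of the rigid translation of the particles up to [c].  Pairs on the same
    side of the cut do not feel this motion, and crossing pairs contribute minus
    their force. *)
Lemma cut_force_balance (R : realType) (m n alpha : R) N (x : 'rV[R]_N) (c : nat) :
  0 < n -> critical_point m n alpha x ->
  \sum_(i < N) \sum_(j < N | in_range alpha N i j && (i <= c < j)%N)
     force m n (x 0 j - x 0 i) = 0.
Proof.
move=> n0 [xincr xcrit].
pose D (v : 'rV[R]_N) := \sum_(i < N) \sum_(j < N | in_range alpha N i j)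
       (v 0 j - v 0 i) * force m n (x 0 j - x 0 i).
have De k : D (delta_mx 0 k) = 0.
  have [_ e1] := is_derive_energy R m n alpha N x (delta_mx 0 k) n0 xincr.
  by have [_ e2] := xcrit k; rewrite /D -e1 e2.
pose left : 'rV[R]_N := \row_j (j <= c)%N%:R.
have leftE : left = \sum_(k < N | (k <= c)%N) delta_mx 0 k.
  apply/rowP => j; rewrite mxE summxE.
  under eq_bigr do rewrite mxE eqxx /=.
  case: (leqP j c) => jc.
    rewrite (bigD1 j) //= eqxx big1 ?addr0 // => k /andP[_ /negPf kj].
    by rewrite eq_sym kj.
  by rewrite big1 // => k kc; case: eqP => // jk; move: jc kc; rewrite jk; lia.
have : D left = 0.
  have <- : \sum_(k < N | (k <= c)%N) D (delta_mx 0 k) = 0 by apply: big1.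
  rewrite leftE /D exchange_big; apply: eq_bigr => i _ /=.
  rewrite exchange_big; apply: eq_bigr => j _ /=.
  by rewrite -mulr_suml sumrB !summxE.
move=> /(congr1 -%R); rewrite oppr0 => Dleft; rewrite -[RHS]Dleft /D -sumrN.
apply: eq_bigr => i _; rewrite -sumrN big_mkcondr /=; apply: eq_bigr => j /andP[ij _].
rewrite !mxE (leqNgt j); case: (leqP i c) => ic; case: (ltnP c j) => jc /=.
- by rewrite sub0r mulN1r opprK.
- by rewrite subrr mul0r oppr0.
- by rewrite subrr mul0r oppr0.
- lia.
Qed.

(** * Pointwise bounds on the force *)

Lemma powRN_antitone (R : realType) (a b e : R) :
  0 < a -> a <= b -> 0 <= e -> b `^ (- e) <= a `^ (- e).
Proof.
move=> a0 ab e0; have b0 := lt_le_trans a0 ab.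
rewrite !powRN lef_pV2 ?posrE ?powR_gt0 //.
by apply: ge0_ler_powR => //; rewrite nnegrE ltW.
Qed.

Lemma powR_gt1 (R : realType) (a e : R) : 1 < a -> 0 < e -> 1 < a `^ e.
Proof.
move=> a1 e0; rewrite -[ltLHS](congr1 (@^~ e) (powR1 R)).
by apply: gt0_ltr_powR => //; rewrite ?nnegrE ?ltW // (lt_trans _ a1).
Qed.

Lemma powRN_lt1 (R : realType) (a e : R) : 1 < a -> e < 0 -> a `^ e < 1.
Proof.
move=> a1 e0; rewrite -[e]opprK powRN invf_lt1; first by rewrite powR_gt1 ?oppr_gt0.
by rewrite powR_gt0 // (lt_trans _ a1).
Qed.

Lemma force_gt0 (R : realType) (m n r : R) : m < n -> 1 < r -> 0 < force m n r.
Proof.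
move=> mn r1; have r0 : 0 < r by lra.
have -> : force m n r = r `^ (- n - 1) * (r `^ (n - m) - 1).
  rewrite mulrBr mulr1 -powRD ?(gt_eqF r0) ?implybT // /force.
  by congr (_ `^ _ - _); ring.
by rewrite mulr_gt0 ?powR_gt0 // subr_gt0 powR_gt1 // subr_gt0.
Qed.

(** Beyond distance 2 the repulsion is at most the fraction [2 `^ (m - n) < 1] of
    the attraction, and at distances between [d] and 2 it is at most
    [d `^ (- n - 1)].  The threshold has to exceed 1, where the two balance. *)
Lemma force_ge (R : realType) (m n d r : R) : -1 < m < 1 -> 1 < n -> 0 < d -> d <= r ->
  (1 - 2 `^ (m - n)) * r `^ (- m - 1) - (r <= 2)%R%:R * d `^ (- n - 1) <= force m n r.
Proof.
move=> /andP[m1 m1'] n1 d0 dr; have r0 := lt_le_trans d0 dr; rewrite /force mulrBl mul1r.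
have le0 : 0 <= 2 `^ (m - n) * r `^ (- m - 1) by rewrite mulr_ge0 ?powR_ge0.
case: (leP r 2) => r2 /=.
  rewrite mul1r; have : r `^ (- n - 1) <= d `^ (- n - 1).
    by rewrite -opprD; apply: powRN_antitone => //; lra.
  lra.
suff : r `^ (- n - 1) <= 2 `^ (m - n) * r `^ (- m - 1) by lra.
have -> : - n - 1 = (m - n) + (- m - 1) by ring.
rewrite powRD ?(gt_eqF r0) ?implybT // ler_wpM2r ?powR_ge0 // -opprB.
by apply: powRN_antitone; lra.
Qed.

(** * Gaps in a chain whose cuts are balanced *)

(** The positions are a sequence indexed by [nat], so that the index of a
    neighbour is just a successor; [rg] tells which pairs interact. *)
Definition cuts_balanced {R : realType} (m n : R) (N : nat) (rg : rel nat)
    (y : nat -> R) : Prop :=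
  forall c, \sum_(i < N) \sum_(j < N | rg i j && (i <= c < j)%N)
     force m n (y j - y i) = 0.

Definition increasing_below {R : realType} (N : nat) (y : nat -> R) : Prop :=
  forall i j : nat, (i < j < N)%N -> y i < y j.

Definition crowd {R : realType} (N : nat) (y : nat -> R) (c : nat) : R :=
  \sum_(k < N) (`|y k - y c| <= 2)%R%:R.

Lemma increasing_below_le (R : realType) N (y : nat -> R) (i j : nat) :
  increasing_below N y -> (i <= j < N)%N -> y i <= y j.
Proof.
move=> yi /andP[]; rewrite leq_eqVlt => /orP[/eqP -> //|ij jN].
by rewrite ltW // yi // ij.
Qed.

Lemma gap_le_crossing (R : realType) N (y : nat -> R) (i j c : nat) :
  increasing_below N y -> (i <= c < j)%N -> (j < N)%N ->
  y c.+1 - y c <= y j - y i.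
Proof.
move=> yi /andP[ic cj] jN.
have := increasing_below_le _ _ _ i c yi ; have := increasing_below_le _ _ _ c.+1 j yi.
have -> : (i <= c < N)%N by lia.
have -> : (c < j < N)%N by lia.
move=> /(_ isT) ? /(_ isT) ?; lra.
Qed.

(** Every distance across a gap exceeds that gap, so a gap larger than 1 would
    have only attractive forces across it, and they could not balance. *)
Lemma gap_le1 (R : realType) (m n : R) N rg (y : nat -> R) c :
  m < n -> increasing_below N y -> cuts_balanced m n N rg y ->
  (c.+1 < N)%N -> rg c c.+1 -> y c.+1 - y c <= 1.
Proof.
move=> mn yi bal cN rc; rewrite leNgt; apply/negP => gap1.
have pos i j : (i <= c < j)%N -> (j < N)%N -> 0 < force m n (y j - y i).
  move=> ij jN; apply: force_gt0 => //.
  exact: lt_le_trans gap1 (gap_le_crossing _ _ _ _ _ _ yi ij jN).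
have pos_row (i : 'I_N) : 0 <= \sum_(j < N | rg i j && (i <= c < j)%N) force m n (y j - y i).
  by apply: sumr_ge0 => j /andP[_ ij]; exact/ltW/pos.
have /(psumr_eq0P (fun i _ => pos_row i)) row0 := bal c.
have := row0 (Ordinal (ltnW cN)) isT => /psumr_eq0P zero.
have := zero (fun j => fun h => ltW (pos _ _ (proj2 (andP h)) (ltn_ord j))) (Ordinal cN).
rewrite /= rc leqnn ltnSn => /(_ isT) f0.
by have := pos c c.+1; rewrite f0 leqnn ltnSn ltxx cN => /(_ isT isT).
Qed.

Lemma dist_le_index (R : realType) N (y : nat -> R) :
  (forall c, (c.+1 < N)%N -> y c.+1 - y c <= 1) ->
  forall i j, (i <= j < N)%N -> y j - y i <= (j - i)%N%:R.
Proof.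
move=> gap1 i j /andP[/subnKC <-]; elim: (j - i)%N => [|k IH] kN.
  by rewrite addn0 !subrr subnn.
have {}IH := IH (ltnW _); have {IH} : y (i + k)%N - y i <= (i + k - i)%N%:R.
  by apply: IH; rewrite -addnS.
have := gap1 (i + k)%N; rewrite -addnS => /(_ kN).
by rewrite !addKn -addn1 natrD; lra.
Qed.

Lemma sum_index_interval (N a b : nat) : (a <= b <= N)%N ->
  (\sum_(i < N) (a <= i < b) = b - a)%N.
Proof.
move=> /andP[ab bN].
suff -> : (\sum_(i < N) (a <= i < b) = minn b N - minn a N)%N by lia.
elim: N {bN} => [|N IH]; first by rewrite big_ord0; lia.
by rewrite big_ord_recr /= IH; case: (leqP a N); case: (ltnP N b) => /=; lia.
Qed.

(** Across a gap of length at least [d], the attraction of the [p] particles on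
    each side can only be balanced by the repulsion of crossing pairs at distance
    at most 2, both members of which are counted by the crowd at [c]. *)
Lemma crowd_ge (R : realType) (m n d : R) N rg (y : nat -> R) (p c : nat) :
  -1 < m < 1 -> 1 < n -> 0 < d ->
  increasing_below N y -> cuts_balanced m n N rg y ->
  (forall i j, (i < j < N)%N -> (j - i < p.*2)%N -> rg i j) ->
  (0 < p)%N -> (p <= c.+1)%N -> (c.+1 + p <= N)%N ->
  d <= y c.+1 - y c ->
  (1 - 2 `^ (m - n)) * (p%:R ^+ 2 * (2 * p%:R) `^ (- m - 1)) * d `^ (n + 1)
    <= crowd N y c ^+ 2.
Proof.
move=> hm n1 d0 yi bal rgp p0 pc cpN dgap; have /andP[m1 m1'] := hm.
have gap1 k : (k.+1 < N)%N -> y k.+1 - y k <= 1.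
  move=> kN; apply: (@gap_le1 R m n N rg) => //; first lra.
  by apply: rgp; [rewrite leqnn|lia].
set kap := 1 - 2 `^ (m - n).
have kap0 : 0 <= kap.
  by rewrite subr_ge0 ltW // powRN_lt1; lra.
set s : R := (2 * p%:R) `^ (- m - 1).
(* T is the attraction across the cut, and Q the number of crossing pairs that
   are close enough for the repulsion to matter. *)
pose T := \sum_(i < N) \sum_(j < N | rg i j && (i <= c < j)%N) (y j - y i) `^ (- m - 1).
pose Q : R := \sum_(i < N) \sum_(j < N | rg i j && (i <= c < j)%N) (y j - y i <= 2)%R%:R.
have TQ : kap * T <= Q * d `^ (- n - 1).
  rewrite -subr_le0 -(bal c) /T /Q mulr_sumr mulr_suml -sumrB.
  apply: ler_sum => i _; rewrite mulr_sumr mulr_suml -sumrB.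
  apply: ler_sum => j /andP[_ ij]; apply: force_ge => //.
  exact: le_trans dgap (gap_le_crossing _ _ _ _ _ _ yi ij (ltn_ord j)).
have QP : Q <= crowd N y c ^+ 2.
  rewrite expr2 /crowd big_distrlr /=; apply: ler_sum => i _.
  rewrite big_mkcond; apply: ler_sum => j _ /=.
  case: ifP => [/andP[_ /andP[ic cj]]|_]; last by rewrite mulr_ge0 ?ler0n.
  have yic : y i <= y c by apply: increasing_below_le yi _; have := ltn_ord j; lia.
  have ycj : y c <= y j by apply: increasing_below_le yi _; have := ltn_ord j; lia.
  case: (leP (y j - y i) 2) => ji2 /=; last by rewrite mulr_ge0 ?ler0n.
  rewrite !ler_norml.
  have -> : -2 <= y i - y c <= 2 by apply/andP; split; lra.
  have -> : -2 <= y j - y c <= 2 by apply/andP; split; lra.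
  by rewrite mulr1.
(* Keep only the pairs with c - p < i <= c < j <= c + p. *)
have Tp : p%:R ^+ 2 * s <= T.
  have cnt a b : (a <= b <= N)%N -> (\sum_(i < N) (a <= i < b)%N%:R : R) = (b - a)%N%:R.
    by move=> h; rewrite -natr_sum sum_index_interval.
  have -> : p%:R ^+ 2 * s =
     \sum_(i < N) \sum_(j < N) (c.+1 - p <= i < c.+1)%N%:R * (c.+1 <= j < c.+1 + p)%N%:R * s.
    rewrite expr2 -[X in X * _ * s](congr1 (fun k => k%:R) (subKn pc)).
    rewrite -[X in _ * X * s](congr1 (fun k => k%:R) (addKn c.+1 p)).
    rewrite -!cnt; [|lia|lia]; rewrite big_distrlr mulr_suml.
    by apply: eq_bigr => i _; rewrite mulr_suml.
  apply: ler_sum => i _; rewrite [leRHS]big_mkcond; apply: ler_sum => j _ /=.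
  case: (boolP (c.+1 - p <= i < c.+1)%N) => [/andP[pi ic]|_]; last first.
    by rewrite !mul0r; case: ifP; rewrite ?powR_ge0.
  case: (boolP (c.+1 <= j < c.+1 + p)%N) => [/andP[cj jp]|_]; last first.
    by rewrite mulr0 !mul0r; case: ifP; rewrite ?powR_ge0.
  have jN := ltn_ord j.
  rewrite rgp; [|lia|lia]; rewrite -ltnS ic cj /= !mul1r /s -opprD.
  apply: powRN_antitone; last lra.
    by rewrite subr_gt0 yi //; lia.
  have h1 : y j - y i <= (j - i)%N%:R by apply: dist_le_index gap1 _ _ _; lia.
  apply: (le_trans h1); rewrite -natrM ler_nat; lia.
have dn0 : 0 < d `^ (n + 1) by rewrite powR_gt0.
apply: (@le_trans _ _ (kap * T * d `^ (n + 1))).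
  by rewrite ler_pM2r // ler_wpM2l.
apply: le_trans QP; rewrite -ler_pdivlMr // -powRN.
by have -> : - (n + 1) = - n - 1 by ring.
Qed.

(** Truncating the positions to [[a, b + 1]] does not change the gaps that start in
    [[a, b]], since they are at most 1, and keeps the other ones nonnegative; the
    truncated gaps telescope to at most [b + 1 - a]. *)
Lemma sum_gaps_window (R : realType) (y : nat -> R) (M : nat) (a b : R) : a <= b ->
  (forall c, (c < M)%N -> 0 <= y c.+1 - y c <= 1) ->
  \sum_(c < M) (y c.+1 - y c) * (a <= y c <= b)%R%:R <= b - a + 1.
Proof.
move=> ab gap.
pose clamp t := Num.min (Num.max a t) (b + 1).
have clampB t : a <= clamp t <= b + 1.
  by rewrite /clamp le_min ge_min le_max !lexx orbT /= andbT; lra.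
have clamp_id t : a <= t <= b + 1 -> clamp t = t.
  by move=> /andP[at_ tb]; rewrite /clamp max_r // min_l.
have clamp_le u v : u <= v -> clamp u <= clamp v.
  move=> uv; rewrite /clamp le_min !ge_min lexx orbT andbT.
  by rewrite le_max2.
apply: (@le_trans _ _ (\sum_(0 <= c < M) (clamp (y c.+1) - clamp (y c)))).
  rewrite big_mkord; apply: ler_sum => c _.
  have /andP[g0 g1] := gap c (ltn_ord c).
  case: (boolP (a <= y c <= b)) => [/andP[ac cb]|_] /=.
    by rewrite mulr1 !clamp_id //; apply/andP; split; lra.
  by rewrite mulr0 subr_ge0 clamp_le // -subr_ge0.
rewrite telescope_sumr //.
have := clampB (y M); have := clampB (y 0%N); lra.
Qed.

(** Exchanging the sums turns the crowd of a gap into the gaps around a particle: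
    they start in an interval of length 4 and so cover a length at most 5. *)
Lemma sum_gap_crowd (R : realType) (y : nat -> R) (N M : nat) :
  (forall c, (c < M)%N -> 0 <= y c.+1 - y c <= 1) ->
  \sum_(c < M) (y c.+1 - y c) * crowd N y c <= 5 * N%:R.
Proof.
move=> gap; rewrite /crowd.
under eq_bigr do rewrite mulr_sumr.
rewrite exchange_big /=.
have -> : 5 * N%:R = \sum_(k < N) (5 : R) by rewrite sumr_const card_ord mulr_natr.
apply: ler_sum => k _.
have := sum_gaps_window R y M (y k - 2) (y k + 2).
have -> : y k + 2 - (y k - 2) + 1 = 5 by ring.
move=> h; apply: le_trans (h _ gap); last by lra.
apply: ler_sum => c _; rewrite le_eqVlt; apply/orP; left; apply/eqP.
congr (_ * (_ : bool)%:R); rewrite ler_norml.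
by apply/andP/andP => -[] *; split; lra.
Qed.

(** A gap is either smaller than [d], or in a crowd of at least [P], or one of the
    [p] gaps at either end; here [M] is the number of gaps. *)
Lemma size_le_cuts (R : realType) (m n d P : R) M rg (y : nat -> R) (p : nat) :
  -1 < m < 1 -> 1 < n -> 0 < d -> 0 < P ->
  increasing_below M.+1 y -> cuts_balanced m n M.+1 rg y ->
  (forall i j, (i < j < M.+1)%N -> (j - i < p.*2)%N -> rg i j) ->
  (0 < p)%N ->
  P ^+ 2 <= (1 - 2 `^ (m - n)) * (p%:R ^+ 2 * (2 * p%:R) `^ (- m - 1)) * d `^ (n + 1) ->
  y M - y 0%N <= M.+1%:R * d + 5 * M.+1%:R / P + 2 * p%:R.
Proof.
move=> hm n1 d0 P0 yi bal rgp p0 PP; have /andP[m1 m1'] := hm.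
have gap1 k : (k < M)%N -> 0 <= y k.+1 - y k <= 1.
  move=> kN; rewrite subr_ge0 ltW ?yi ?leqnn //=.
  apply: (@gap_le1 R m n M.+1 rg) => //; first lra.
  by apply: rgp; [rewrite leqnn|lia].
have crowd0 c : 0 <= crowd M.+1 y c :> R by apply: sumr_ge0 => k _; rewrite ler0n.
rewrite -(telescope_sumr (fun k => y k)) // big_mkord.
(* The three cases are added up instead of being distinguished: a gap in a crowd
   is at most gap * crowd / P, and an end gap is at most 1. *)
have pt (c : 'I_M) : y c.+1 - y c <= d + (y c.+1 - y c) * crowd M.+1 y c / P
     + ((0 <= c < p)%N%:R + (M - p <= c < M)%N%:R).
  have /andP[g0 g1] := gap1 c (ltn_ord c).
  have gP : 0 <= (y c.+1 - y c) * crowd M.+1 y c / P.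
    by rewrite !mulr_ge0 ?invr_ge0 // ltW.
  have cM := ltn_ord c; rewrite cM leq0n /= andbT.
  have b0 (b : bool) : 0 <= b%:R :> R := ler0n _ _.
  case: (ltnP c p) => cp /=; first by have := b0 (M - p <= c)%N; lra.
  case: (leqP (M - p) c) => cp' /=; first by lra.
  have [dg|] := leP d (y c.+1 - y c); last by lra.
  suff PC : P <= crowd M.+1 y c.
    have : y c.+1 - y c <= (y c.+1 - y c) * crowd M.+1 y c / P.
      by rewrite ler_pdivlMr // ler_wpM2l.
    by rewrite /= !addr0; lra.
  rewrite -(@ler_pXn2r _ 2) ?nnegrE ?(ltW P0) //; apply: le_trans PP _.
  by apply: (@crowd_ge R m n d _ rg) => //; lia.
apply: le_trans; first by apply: ler_sum => c _; exact: pt.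
rewrite !big_split /= sumr_const card_ord -mulr_suml -!natr_sum.
have -> : (\sum_(i < M) (M - p <= i < M) = M - (M - p))%N by apply: sum_index_interval; lia.
have s1 : (\sum_(i < M) (0 <= i < p) <= p)%N.
  have -> : (\sum_(i < M) (0 <= i < p) = \sum_(i < M) (0 <= i < minn p M))%N.
    by apply: eq_bigr => i _; rewrite leq_min ltn_ord andbT.
  by rewrite sum_index_interval; lia.
have {s1} s1 : (\sum_(i < M) (0 <= i < p))%N%:R <= p%:R :> R by rewrite ler_nat.
have s2 : (M - (M - p))%N%:R <= p%:R :> R by rewrite ler_nat; lia.
have s3 : d *+ M <= M.+1%:R * d by rewrite -[leLHS]mulr_natl ler_pM2r // ler_nat.
have s4 : (\sum_(c < M) (y c.+1 - y c) * crowd M.+1 y c) / P <= 5 * M.+1%:R / P.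
  by rewrite ler_pM2r ?invr_gt0 //; apply: sum_gap_crowd.
lra.
Qed.

(** * The choice of the scales *)

(** The solution [b] of [alpha * (1 - m) / 2 - b * (n + 1) = 2 * b], for which
    the crowd around a gap of length at least [N `^ (- b)] is at least of order
    [N `^ b]. *)
Definition rate {R : realType} (m n alpha : R) : R := alpha * (1 - m) / (2 * (n + 3)).

(** The first factor is that of [force_ge]; the factor [2 `^ (- m - 3)] comes from
    [p ^+ 2 >= (q / 2) ^+ 2] and [2 * p <= 2 * q] when [p] is the integral part of [q >= 2]. *)
Definition crowd_const {R : realType} (m n : R) : R :=
  (1 - 2 `^ (m - n)) * 2 `^ (- m - 3).

Lemma crowd_const_gt0 (R : realType) (m n : R) : m < n -> 0 < crowd_const m n.
Proof.
by move=> mn; rewrite mulr_gt0 ?powR_gt0 // subr_gt0 powRN_lt1; lra.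
Qed.

Lemma rate_bounds (R : realType) (m n alpha : R) :
  -1 < m < 1 -> 1 < n -> 0 < alpha <= 1 ->
  0 < rate m n alpha /\ rate m n alpha <= 1 - alpha / 2.
Proof.
move=> /andP[m1 m1'] n1 /andP[a0 a1]; rewrite /rate; split.
  by rewrite divr_gt0 ?mulr_gt0 //; lra.
rewrite ler_pdivrMr; last lra.
have : alpha * (1 - m) <= 1 * 2 by apply: ler_pM; lra.
have : (1 - alpha / 2) * (2 * 4) <= (1 - alpha / 2) * (2 * (n + 3)).
  by rewrite ler_wpM2l; lra.
lra.
Qed.

(** The bound of [crowd_ge] at the chosen scales, [A] standing for the number of
    particles. *)
Lemma crowd_lower_bound (R : realType) (m n alpha A : R) (p : nat) :
  -1 < m < 1 -> 1 < n -> 0 < alpha <= 1 -> 0 < A -> 0 < p%:R :> R ->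
  p%:R <= A `^ (alpha / 2) -> A `^ (alpha / 2) <= 2 * p%:R ->
  (Num.sqrt (crowd_const m n) * A `^ rate m n alpha) ^+ 2 <=
  (1 - 2 `^ (m - n)) * (p%:R ^+ 2 * (2 * p%:R) `^ (- m - 1))
    * (A `^ (- rate m n alpha)) `^ (n + 1).
Proof.
move=> hm n1 ha A0 p0; set q := A `^ (alpha / 2) => pq qp.
have /andP[m1 m1'] := hm.
have q0 : 0 < q by rewrite powR_gt0.
have kap0 : 0 <= 1 - 2 `^ (m - n) :> R.
  by rewrite subr_ge0 ltW // powRN_lt1; lra.
have k0 : 0 <= crowd_const m n by apply/ltW/crowd_const_gt0; lra.
rewrite exprMn sqr_sqrtr // /crowd_const.
rewrite -[leLHS]mulrA -[leRHS]mulrA; apply: ler_wpM2l => //.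
have e1 : (A `^ rate m n alpha) ^+ 2 = q `^ (1 - m) * (A `^ (- rate m n alpha)) `^ (n + 1).
  rewrite -powR_mulrn ?powR_ge0 // -!powRrM -powRD ?(gt_eqF A0) ?implybT //.
  by congr (_ `^ _); rewrite /rate; field; lra.
have e2 : q `^ (1 - m) = q ^+ 2 * q `^ (- m - 1).
  rewrite -powR_mulrn ?(ltW q0) // -powRD ?(gt_eqF q0) ?implybT //.
  by congr (_ `^ _); ring.
have e3 : 2 `^ (- m - 3) = 4^-1 * 2 `^ (- m - 1) :> R.
  rewrite (_ : - m - 3 = - 2%:R + (- m - 1)); last by ring.
  by rewrite powRD ?pnatr_eq0 ?implybT // powR_invn // -natrX.
rewrite e1 mulrA; apply: ler_wpM2r; first exact: powR_ge0.
rewrite e2 e3 (_ : 4^-1 * _ * _ = (q ^+ 2 / 4) * (2 `^ (- m - 1) * q `^ (- m - 1))); last by ring.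
rewrite -powRM ?(ltW q0) //; apply: ler_pM; rewrite ?powR_ge0 //.
- by rewrite divr_ge0 // sqr_ge0.
- rewrite ler_pdivrMr // (_ : _ * 4 = (2 * p%:R) ^+ 2); last by ring.
  by rewrite ler_pXn2r // nnegrE ?ltW // mulr_gt0.
- rewrite -opprD; apply: powRN_antitone; [lra|lra|lra].
Qed.

Lemma in_range_le (R : realType) (alpha : R) N (i j : nat) :
  (i < j)%N -> (j - i)%N%:R <= N%:R `^ alpha -> in_range alpha N i j.
Proof. by move=> ij h; rewrite /in_range ij /= floor_ge_int. Qed.

(** The lower bound on [N] says that [q = N `^ (alpha / 2)] is at least 2, so that
    the integral part [p] of [q] satisfies [2 * p <= q ^+ 2 = N `^ alpha]: all the
    pairs needed for [crowd_ge] interact. *)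
Lemma system_size_le (R : realType) (m n alpha : R) (N : nat) (x : 'rV[R]_N) :
  -1 < m < 1 -> 1 < n -> 0 < alpha <= 1 -> 2 `^ (2 / alpha) <= N%:R ->
  critical_point m n alpha x ->
  system_size x <= (3 + 5 / Num.sqrt (crowd_const m n)) * N%:R `^ (1 - rate m n alpha).
Proof.
move=> hm n1 ha NN; have /andP[m1 m1'] := hm; have /andP[a0 a1] := ha.
case: N x NN => [|M] x NN xcrit.
  by move: NN; rewrite leNgt powR_gt0.
have [b0 bmax] := rate_bounds R m n alpha hm n1 ha.
set A : R := M.+1%:R; set b := rate m n alpha in b0 bmax *; set k := crowd_const m n.
have A1 : 1 <= A by rewrite ler1n.
have A0 : 0 < A by lra.
set q := A `^ (alpha / 2).
have q2 : 2 <= q.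
  have e : 2 / alpha * (alpha / 2) = 1 by field; lra.
  apply: (@le_trans _ _ ((2 `^ (2 / alpha)) `^ (alpha / 2))).
    by rewrite -powRrM e powRr1.
  by apply: ge0_ler_powR; rewrite ?nnegrE ?powR_ge0 ?ler0n //; lra.
have /andP[pq qp] := truncn_itv (ltW (lt_le_trans (ltr0n _ 2) q2)).
set p := Num.trunc q in pq qp.
have qp2 : q <= 2 * p%:R by move: qp; rewrite -addn1 natrD; lra.
have p0 : 0 < p%:R :> R by lra.
have kpos : 0 < k by apply: crowd_const_gt0; lra.
have sk : 0 < Num.sqrt k by rewrite sqrtr_gt0.
have Ab : 0 < A `^ b by rewrite powR_gt0.
have [xincr _] := xcrit.
pose y (i : nat) := x 0 (inord i).
have yi : increasing_below M.+1 y.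
  move=> i j /andP[ij jM]; apply: xincr; rewrite !inordK //.
  exact: ltn_trans ij jM.
have bal : cuts_balanced m n M.+1 (in_range alpha M.+1) y.
  move=> c; rewrite -[RHS](cut_force_balance R m n alpha _ x c _ xcrit); last lra.
  by apply: eq_bigr => i _; apply: eq_bigr => j _; rewrite /y !inord_val.
have rgp i j : (i < j < M.+1)%N -> (j - i < p.*2)%N -> in_range alpha M.+1 i j.
  move=> /andP[ij _] jp; apply: in_range_le => //.
  have -> : M.+1%:R `^ alpha = q * q.
    by rewrite -powRD ?(gt_eqF A0) ?implybT //; congr (_ `^ _); field.
  apply: (@le_trans _ _ (2 * q)); last by rewrite ler_wpM2r //; lra.
  apply: (@le_trans _ _ (2 * p%:R)); last by rewrite ler_pM2l.
  by rewrite -natrM ler_nat mul2n ltnW.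
have szE : system_size x = y M - y 0%N.
  by rewrite /system_size /y; congr (x 0 _ - x 0 _); apply/val_inj; rewrite /= inordK.
rewrite szE.
have := size_le_cuts R m n (A `^ (- b)) (Num.sqrt k * A `^ b) M _ y p hm n1
  (powR_gt0 _ A0) (mulr_gt0 sk Ab) yi bal rgp.
rewrite -(ltr0n R) => /(_ p0).
move=> /(_ (crowd_lower_bound R m n alpha A p hm n1 ha A0 p0 pq qp2)).
have AA : A * A `^ (- b) = A `^ (1 - b).
  by rewrite powRD ?(gt_eqF A0) ?implybT // powRr1 // ltW.
rewrite -/A AA.
have -> : 5 * A / (Num.sqrt k * A `^ b) = 5 / Num.sqrt k * A `^ (1 - b).
  by rewrite -AA powRN; field; rewrite !gt_eqF.
have : p%:R <= A `^ (1 - b).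
  by apply: (le_trans pq); apply: ler_powR => //; lra.
lra.
Qed.

(** * Bunching *)

Lemma cvg_powRN_infty (R : realType) (C b : R) : 0 < C -> 0 < b ->
  ((fun N : nat => C * N%:R `^ (- b)) @ \oo --> (0 : R))%classic.
Proof.
move=> C0 b0; apply/cvgr0Pnorm_lt => e e0; near=> N.
have hN : (C / e) `^ b^-1 < N%:R by near: N; exact: nbhs_infty_gtr.
have N0 : 0 < N%:R :> R by apply: le_lt_trans hN; exact: powR_ge0.
rewrite ger0_norm; last by rewrite mulr_ge0 ?powR_ge0 // ltW.
rewrite powRN ltr_pdivrMr ?powR_gt0 // mulrC -ltr_pdivrMr //.
have -> : C / e = ((C / e) `^ b^-1) `^ b.
  by rewrite -powRrM mulVf ?lt0r_neq0 // powRr1 // divr_ge0 ?ltW.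
by apply: gt0_ltr_powR; rewrite ?nnegrE ?powR_ge0 ?ler0n.
Unshelve. all: by end_near. Qed.

Lemma system_size_ge0 (R : realType) N (x : 'rV[R]_N) :
  step_configuration x -> 0 <= system_size x.
Proof.
case: N x => [|M] x xincr //=; rewrite subr_ge0.
have [->//|M0] := eqVneq (ord0 : 'I_M.+1) ord_max.
by rewrite ltW // xincr // lt0n; move: M0; rewrite -val_eqE /= eq_sym.
Qed.

Lemma bunching_of_power_bound (R : realType) (X : forall N : nat, 'rV[R]_N)
    (C b : R) (N0 : nat) : 0 < C -> 0 < b ->
  (forall N, (N0 < N)%N -> 0 <= system_size (X N) <= C * N%:R `^ (1 - b)) ->
  bunching X.
Proof.
move=> C0 b0 bd; rewrite /bunching.
suff h : ((fun N : nat => (system_size (X N) / N%:R)%:E) @ \oo --> 0%:E)%classic.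
  by rewrite is_cvg_limn_esupE; [exact/cvg_lim|apply/cvg_ex; exists 0%:E].
apply: cvg_EFin; first by near=> N.
apply: (@squeeze_cvgr _ _ _ _ (cst 0) (fun N : nat => C * N%:R `^ (- b))).
- near=> N.
  have N0N : (N0 < N)%N by near: N; exact: nbhs_infty_gt.
  have N1 : 0 < N%:R :> R by rewrite ltr0n; case: (N) N0N.
  have /andP[s0 s1] := bd N N0N.
  rewrite divr_ge0 ?(ltW N1) //= ler_pdivrMr // (le_trans s1) // -mulrA ler_pM2l //.
  rewrite -[X in _ * X]powRr1 ?(ltW N1) // -powRD ?(gt_eqF N1) ?implybT //.
  by rewrite addrC.
- exact: cvg_cst.
- exact: cvg_powRN_infty.
Unshelve. all: by end_near. Qed.

Theorem corollary1 (R : realType) (m n alpha : R)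
    (hm : -1 < m < 1) (hn : 1 < n) (halpha : 0 < alpha <= 1) :
  (exists (C beta : R) (N0 : nat),
     [/\ 0 < C, 0 < beta, (0 < N0)%N &
       forall N : nat, (N0 < N)%N ->
       forall x : 'rV[R]_N, critical_point m n alpha x ->
         system_size x <= C * N%:R `^ (1 - beta)])
  /\
  (forall X : (forall N : nat, 'rV[R]_N),
     (forall N : nat, (0 < N)%N -> critical_point m n alpha (X N)) ->
     bunching X).
Proof.
have [b0 _] := rate_bounds R m n alpha hm hn halpha.
have k0 : 0 < crowd_const m n by apply: crowd_const_gt0; case/andP: hm => *; lra.
pose C := 3 + 5 / Num.sqrt (crowd_const m n).
have C0 : 0 < C by rewrite addr_gt0 // divr_gt0 // sqrtr_gt0.
pose N0 := (Num.trunc (2 `^ (2 / alpha) : R)).+1.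
have bound N : (N0 < N)%N -> forall x : 'rV[R]_N, critical_point m n alpha x ->
    system_size x <= C * N%:R `^ (1 - rate m n alpha).
  move=> N0N x xcrit; apply: system_size_le => //.
  by apply: ltW; apply: (lt_trans (truncnS_gt _)); rewrite ltr_nat.
split; first by exists C, (rate m n alpha), N0.
move=> X Xcrit; apply: (@bunching_of_power_bound R X C (rate m n alpha) N0) => // N N0N.
have Ncrit : critical_point m n alpha (X N) by apply: Xcrit; exact: leq_ltn_trans N0N.
by rewrite system_size_ge0 ?bound //; case: Ncrit.
Qed.
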